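(* Let $n \le 3$ (with $n\ge 1$ an integer). For every submodular pair $(Q,c)$, i.e. every symmetric $Q \in \mathbb{R}^{n\times n}$ with $Q_{ij}\le 0$ for all $i\neq j$ and every $c\in\mathbb{R}^n$, the SDP relaxation $$\min\left\{ Q\bullet X + c^Tx \;:\; X \le xe^T,\ \begin{pmatrix}1 & x^T\\ x & X\end{pmatrix}\succeq 0\right\}$$ of the problem $$\min\{x^TQx + c^Tx : x\in[0,1]^n\}$$ is tight, i.e. the two optimal values are equal.
   Context: The SDP variables are $x\in\mathbb{R}^n$ and $X$ a symmetric real $n\times n$ matrix. $e$ is the all-ones vector, $A\bullet B = \mathrm{trace}(A^TB)$, $\succeq 0$ means positive semidefinite, and the matrix inequality $X\le xe^T$ is entrywise, i.e. $X_{ij}\le x_i$ for all $i,j\in\{1,\dots,n\}$ (including $i=j$). No sign restriction is placed on $c$ or on the diagonal of $Q$. *)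

(* Defs.v *)
From mathcomp Require Import all_boot all_order all_algebra.
From mathcomp Require Import all_classical all_reals.

Set Implicit Arguments.
Unset Strict Implicit.
Unset Printing Implicit Defensive.

Import Order.TTheory GRing.Theory Num.Theory.

Local Open Scope classical_set_scope.
Local Open Scope ring_scope.

Definition frobenius (R : realType) (m n : nat) (A B : 'M[R]_(m, n)) : R :=
  \tr (A^T *m B).

Definition psd (R : realType) (n : nat) (M : 'M[R]_n) : Prop :=
  M^T = M /\ forall v : 'cV[R]_n, 0 <= (v^T *m M *m v) 0 0.

Definition qp_objective (R : realType) (n : nat) (Q : 'M[R]_n) (c : 'cV[R]_n)
    (x : 'cV[R]_n) : R :=
  (x^T *m Q *m x) 0 0 + (c^T *m x) 0 0.

Definition qp_feasible (R : realType) (n : nat) : set 'cV[R]_n :=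
  [set x | forall i, 0 <= x i 0 <= 1].

Definition sdp_objective (R : realType) (n : nat) (Q : 'M[R]_n) (c : 'cV[R]_n)
    (p : 'cV[R]_n * 'M[R]_n) : R :=
  frobenius Q p.2 + (c^T *m p.1) 0 0.

(* [p.1 *m (const_mx 1)^T] is the matrix x e^T, whose (i, j) entry is x_i. *)
Definition sdp_feasible (R : realType) (n : nat) : set ('cV[R]_n * 'M[R]_n) :=
  [set p | [/\ p.2^T = p.2,
               forall i j, p.2 i j <= (p.1 *m (const_mx 1 : 'cV[R]_n)^T) i j
             & psd (block_mx (1%:M : 'M[R]_1) p.1^T p.1 p.2)]].

(* The minimum is attained by definition, so no junk value (such as that of
   [inf] on an empty or unbounded set) can intervene. *)
Definition is_min_value (R : realType) (T : Type) (S : set T) (f : T -> R)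
    (v : R) : Prop :=
  (f @` S) v /\ lbound (f @` S) v.

Definition sdp_tight (R : realType) (n : nat) (Q : 'M[R]_n) (c : 'cV[R]_n)
    : Prop :=
  exists v : R, is_min_value (@qp_feasible R n) (qp_objective Q c) v /\
                is_min_value (@sdp_feasible R n) (sdp_objective Q c) v.

(* Main.v *)
Require Import Defs.
From mathcomp Require Import all_boot all_order all_algebra.
From mathcomp Require Import all_classical all_reals.
From mathcomp Require Import topology normedtype derive.
From mathcomp Require Import ring lra.

(* Read a feasible (x, X) as the pseudo-moments x_i = E Y_i, X_ij = E Y_i Y_j of
   a random vector Y.  As Q is submodular, it suffices to find a genuine random
   vector in the box with E Y_i = x_i, E Y_i^2 = X_ii, E Y_i Y_j >= X_ij for
   i <> j (for the diagonal of the middle coordinate below, a bound on the side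
   that the sign of Q_ii requires).  Put
   p_i = (1 - x_i)^2 / E (1 - Y_i)^2 and r_i = x_i^2 / X_ii; then p_i + r_i >= 1.
   Take i minimizing p and k minimizing r.  If p_i + r_k >= 1, a two-point law
   whose coordinates are all perfectly correlated stays in the box, and it
   dominates X by Cauchy-Schwarz; this works for every n.  Otherwise i <> k, and
   (Y_i, Y_k) takes the values (1 - e, 0), (1, 0), (1, f) on three events B, M, T,
   so that E Y_i Y_k = x_k is as large as possible.  The pseudo-indicators of B
   and T are affine in Y_i and Y_k, so (x, X) prescribes conditional means of the
   remaining coordinate on B and T; these can be realized, possibly after
   averaging over adjacent events, with second moment at most that of X. *)

Set Implicit Arguments.
Unset Strict Implicit.
Unset Printing Implicit Defensive.

Import Order.TTheory GRing.Theory Num.Theory.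
Import numFieldNormedType.Exports.

Local Open Scope classical_set_scope.
Local Open Scope ring_scope.

(** * Three coordinates in scalar form: laws on two or three events *)

Definition obj3 (R : pzRingType) (q11 q22 q33 q12 q13 q23 c1 c2 c3 : R)
    (x1 x2 x3 X11 X22 X33 X12 X13 X23 : R) : R :=
  q11 * X11 + q22 * X22 + q33 * X33 + 2 * (q12 * X12 + q13 * X13 + q23 * X23)
  + (c1 * x1 + c2 * x2 + c3 * x3).

Definition submod3_lbound (R : realFieldType) (q11 q22 q33 q12 q13 q23 c1 c2 c3 v : R) :=
  [/\ q12 <= 0, q13 <= 0, q23 <= 0 &
   forall y1 y2 y3, 0 <= y1 <= 1 -> 0 <= y2 <= 1 -> 0 <= y3 <= 1 ->
   v <= obj3 q11 q22 q33 q12 q13 q23 c1 c2 c3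
          y1 y2 y3 (y1 * y1) (y2 * y2) (y3 * y3) (y1 * y2) (y1 * y3) (y2 * y3)].

(** Cauchy-Schwarz for a 2x2 form without square roots: [D] is any upper bound of the geometric mean
    of [A] and [B]. *)
Lemma psd2_le (R : realFieldType) (A B C D : R) :
  (forall b t, 0 <= b ^+ 2 * A + 2 * (b * t * C) + t ^+ 2 * B) ->
  0 <= A -> 0 <= D -> A * B <= D ^+ 2 -> C <= D.
Proof.
move=> psd A0 D0 ABD; rewrite leNgt; apply/negP => DC.
have C0 : 0 < C by apply: le_lt_trans DC.
have DC2 : D ^+ 2 < C ^+ 2 by rewrite ltr_pXn2r // nnegrE // ltW.
have C20 := exprn_gt0 2 C0.
move: A0; rewrite le_eqVlt => /orP[/eqP A0|A0].
  (* With [A = 0] the form takes the value [-4 C^2] at this vector. *)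
  have := psd (- (B + 1)) (2 * C); rewrite -A0; lra.
have : 0 <= A * (A * B - C ^+ 2) by have := psd (- C) A; lra.
by rewrite pmulr_rge0 // => ?; lra.
Qed.

(* The second moment s is that of the constant b, or of a Bernoulli variable of mean b. *)
Lemma obj3_ge_mix (R : realFieldType) (q11 q22 q33 q12 q13 q23 c1 c2 c3 v : R)
    (y1 y3 b s : R) :
  submod3_lbound q11 q22 q33 q12 q13 q23 c1 c2 c3 v ->
  0 <= y1 <= 1 -> 0 <= y3 <= 1 -> 0 <= b <= 1 ->
  s = (if 0 <= q22 then b * b else b) ->
  v <= obj3 q11 q22 q33 q12 q13 q23 c1 c2 c3
         y1 b y3 (y1 * y1) s (y3 * y3) (y1 * b) (y1 * y3) (b * y3).
Proof.
move=> [_ _ _ v_le] h1 h3 hb ->; case: ifP => _; first exact: v_le.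
(* For [q22 < 0] the middle coordinate is Bernoulli: average its values 0 and 1 with weights [1 - b]
   and [b]. *)
have h0 : v <= obj3 q11 q22 q33 q12 q13 q23 c1 c2 c3
    y1 0 y3 (y1 * y1) (0 * 0) (y3 * y3) (y1 * 0) (y1 * y3) (0 * y3).
  by apply: v_le => //; rewrite lexx ler01.
have h1' : v <= obj3 q11 q22 q33 q12 q13 q23 c1 c2 c3
    y1 1 y3 (y1 * y1) (1 * 1) (y3 * y3) (y1 * 1) (y1 * y3) (1 * y3).
  by apply: v_le => //; rewrite lexx ler01.
have /andP[b0 b1] := hb.
rewrite -subr_ge0 in h0; rewrite -subr_ge0 in h1'.
have b1' : 0 <= 1 - b by rewrite subr_ge0.
have := mulr_ge0 b1' h0; have := mulr_ge0 b0 h1'.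
by rewrite /obj3 => A B; lra.
Qed.

(* The atoms are (1 - e, b0, 0), (1, b1, 0), (1, b2, f), of weights p, 1 - p - r, r. *)
Lemma obj3_ge_three_atoms (R : realFieldType) (q11 q22 q33 q12 q13 q23 c1 c2 c3 v : R)
    (p r e f b0 b1 b2 x2 X22 X12 X13 X23 : R) :
  submod3_lbound q11 q22 q33 q12 q13 q23 c1 c2 c3 v ->
  0 <= p -> 0 <= r -> p + r <= 1 -> 0 <= e <= 1 -> 0 <= f <= 1 ->
  0 <= b0 <= 1 -> 0 <= b1 <= 1 -> 0 <= b2 <= 1 ->
  x2 = p * b0 + (1 - p - r) * b1 + r * b2 ->
  p * b0 ^+ 2 + (1 - p - r) * b1 ^+ 2 + r * b2 ^+ 2 <= X22 -> X22 <= x2 ->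
  X12 <= x2 - p * e * b0 -> X13 <= r * f -> X23 <= r * f * b2 ->
  v <= obj3 q11 q22 q33 q12 q13 q23 c1 c2 c3 (1 - p * e) x2 (r * f)
         (p * e ^+ 2 + 1 - 2 * (p * e)) X22 (r * f ^+ 2) X12 X13 X23.
Proof.
move=> sub p0 r0 pr he hf hb0 hb1 hb2 ex2 l22 u22 u12 u13 u23.
have [q12_le0 q13_le0 q23_le0 _] := sub.
have w0 : 0 <= 1 - p - r by lra.
have z0 : 0 <= (0 : R) <= 1 by rewrite lexx ler01.
have z1 : 0 <= (1 : R) <= 1 by rewrite lexx ler01.
have e' : 0 <= 1 - e <= 1 by lra.
have := obj3_ge_mix sub e' z0 hb0 erefl; rewrite -subr_ge0 => /(mulr_ge0 p0) A.
have := obj3_ge_mix sub z1 z0 hb1 erefl; rewrite -subr_ge0 => /(mulr_ge0 w0) B.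
have := obj3_ge_mix sub z1 hf hb2 erefl; rewrite -subr_ge0 => /(mulr_ge0 r0) C.
(* As the off-diagonal coefficients are nonpositive, replacing the moments of the law by smaller
   ones can only raise the objective. *)
have D12 : 0 <= - q12 * (x2 - p * e * b0 - X12) by rewrite mulr_ge0 ?oppr_ge0 ?subr_ge0.
have D13 : 0 <= - q13 * (r * f - X13) by rewrite mulr_ge0 ?oppr_ge0 ?subr_ge0.
have D23 : 0 <= - q23 * (r * f * b2 - X23) by rewrite mulr_ge0 ?oppr_ge0 ?subr_ge0.
move: A B C; rewrite /obj3; case: ifPn => q22s A B C.
  have D22 : 0 <= q22 * (X22 - (p * b0 ^+ 2 + (1 - p - r) * b1 ^+ 2 + r * b2 ^+ 2)).
    by rewrite mulr_ge0 ?subr_ge0.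
  by rewrite ex2 in D12 *; clear - A B C D12 D13 D23 D22; lra.
have D22 : 0 <= - q22 * (x2 - X22).
  by rewrite mulr_ge0 ?subr_ge0 // oppr_ge0 ltW // ltNge.
by rewrite ex2 in D12 D22 *; clear - A B C D12 D13 D23 D22; lra.
Qed.

(* [beta0] and [beta2] are the conditional pseudo-means of [Y2] given the events
   B = {Y1 < 1} (of probability [p]) and T = {Y3 > 0} (of probability [r]); [eps]
   is the pseudo-probability of B and T both occurring. *)
Lemma obj3_ge_of_events (R : realFieldType) (q11 q22 q33 q12 q13 q23 c1 c2 c3 v : R)
    (p r e f beta0 beta2 eps x2 X22 : R) :
  submod3_lbound q11 q22 q33 q12 q13 q23 c1 c2 c3 v ->
  0 < p -> 0 < r -> p + r < 1 -> 0 <= e <= 1 -> 0 <= f <= 1 ->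
  0 <= beta0 -> beta2 <= 1 -> 0 <= eps ->
  (forall a b c d, 0 <= a ^+ 2 + p * b ^+ 2 + X22 * c ^+ 2 + r * d ^+ 2
     + 2 * (a * b * p + a * c * x2 + a * d * r + b * c * (p * beta0)
            + b * d * eps + c * d * (r * beta2))) ->
  0 <= x2 <= 1 -> X22 <= x2 ->
  p * (1 - 2 * x2 + X22) <= (1 - x2) ^+ 2 -> r * X22 <= x2 ^+ 2 ->
  v <= obj3 q11 q22 q33 q12 q13 q23 c1 c2 c3
         (1 - p * e) x2 (r * f)
         (p * e ^+ 2 + 1 - 2 * (p * e)) X22 (r * f ^+ 2)
         (x2 - p * e * beta0) (r * f - e * f * eps) (r * f * beta2).
Proof.
move=> sub p0 r0 pr he hf beta0_ge0 beta2_le1 eps0 psd hx2 u22 hp hr.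
have pe0 : 0 <= p * e by apply: mulr_ge0; lra.
have rf0 : 0 <= r * f by apply: mulr_ge0; lra.
have efe : 0 <= e * f * eps by rewrite mulr_ge0 // mulr_ge0; lra.
have [p1 r1] : 0 < 1 - p /\ 0 < 1 - r by lra.
have m0 : 0 < 1 - p - r by lra.
(* [bs] and [bt] are the pseudo-means of [Y2] off B and off T; [bm] is the mean left for M once B
   and T carry [beta0] and [beta2]. *)
have [bs Ebs] : exists b, x2 = p * beta0 + (1 - p) * b.
  by exists ((x2 - p * beta0) / (1 - p)); field; lra.
have [bt Ebt] : exists b, x2 = r * beta2 + (1 - r) * b.
  by exists ((x2 - r * beta2) / (1 - r)); field; lra.
have [bm Ebm] : exists b, x2 = p * beta0 + (1 - p - r) * b + r * beta2.
  by exists ((x2 - p * beta0 - r * beta2) / (1 - p - r)); field; lra.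
have bs1 : bs <= 1.
  (* Cauchy-Schwarz for the pseudo-indicator of B and [1 - Y2]; for [bt] below, that of T and
     [Y2]. *)
  have : p * (1 - beta0) <= 1 - x2.
    apply: (@psd2_le _ p (1 - 2 * x2 + X22)) => //; [|exact: ltW|clear - hx2; lra].
    by move=> b t; have := psd t b (- t) 0; lra.
  by move=> h; rewrite -(ler_pM2l p1); clear - h Ebs; lra.
have bt0 : 0 <= bt.
  have : r * beta2 <= x2.
    apply: (@psd2_le _ r X22) => //; [|exact: ltW|clear - hx2; lra].
    by move=> b t; have := psd 0 0 t b; lra.
  by move=> h; rewrite -(ler_pM2l r1); clear - h Ebt; lra.
(* Lowering the value on B and raising it on T only increases the cross moments, so out-of-order
   means may be pooled in these directions. *)
have fin b0 b1 b2 : b0 <= beta0 -> beta2 <= b2 ->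
  0 <= b0 <= 1 -> 0 <= b1 <= 1 -> 0 <= b2 <= 1 ->
  x2 = p * b0 + (1 - p - r) * b1 + r * b2 ->
  p * b0 ^+ 2 + (1 - p - r) * b1 ^+ 2 + r * b2 ^+ 2 <= X22 ->
  v <= obj3 q11 q22 q33 q12 q13 q23 c1 c2 c3
         (1 - p * e) x2 (r * f)
         (p * e ^+ 2 + 1 - 2 * (p * e)) X22 (r * f ^+ 2)
         (x2 - p * e * beta0) (r * f - e * f * eps) (r * f * beta2).
  move=> h0 h2 hb0 hb1 hb2 ex2 l22.
  apply: (@obj3_ge_three_atoms _ _ _ _ _ _ _ _ _ _ _ p r e f b0 b1 b2) => //;
    try exact: ltW.
  - by rewrite lerD2l lerN2 ler_wpM2l.
  - by rewrite lerBlDr lerDl.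
  - by rewrite ler_wpM2l.
have pooled_left : x2 <= beta2 -> bt <= beta0 ->
    v <= obj3 q11 q22 q33 q12 q13 q23 c1 c2 c3 (1 - p * e) x2 (r * f)
           (p * e ^+ 2 + 1 - 2 * (p * e)) X22 (r * f ^+ 2)
            (x2 - p * e * beta0) (r * f - e * f * eps) (r * f * beta2).
  move=> h2 h0t.
  have ht2 : bt <= beta2 by rewrite -(ler_pM2l r1); clear - Ebt h2; lra.
  apply: (fin bt bt beta2) => //; clear fin.
  - by clear - bt0 ht2 beta2_le1; lra.
  - by clear - bt0 ht2 beta2_le1; lra.
  - by clear - bt0 ht2 beta2_le1; lra.
  - by clear -Ebt; lra.
  (* The square of the residual of [Y2] after projection on 1 and the pseudo-indicator of T. *)
  have := psd (- bt) 0 1 (bt - beta2).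
  have : bt * x2 = bt * (r * beta2 + (1 - r) * bt) by rewrite -Ebt.
  by clear; lra.
(* Pooling of adjacent events: B with M, all three, M with T, or none, depending on the order of the
   means. *)
case: (leP beta0 x2) => h0; last first.
  case: (leP beta2 x2) => h2; last first.
    apply: pooled_left; first exact: ltW.
    have h : r * x2 < r * beta2 by rewrite ltr_pM2l.
    by rewrite -(ler_pM2l r1); have : (1 - r) * x2 < (1 - r) * beta0;
      [rewrite ltr_pM2l | clear - Ebt h; lra].
  apply: (fin x2 x2 x2) => //; clear fin; first exact: ltW.
    by clear; lra.
  by have := psd (- x2) 0 1 0; clear; lra.
have h0s : beta0 <= bs by rewrite -(ler_pM2l p1); clear - Ebs h0; lra.
case: (leP beta2 bs) => h2s.
  apply: (fin beta0 bs bs) => //; clear fin.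
  - by clear - h0s bs1 beta0_ge0; lra.
  - by clear - h0s bs1 beta0_ge0; lra.
  - by clear - h0s bs1 beta0_ge0; lra.
  - by clear - Ebs; lra.
  have := psd (- bs) (bs - beta0) 1 0.
  have : bs * x2 = bs * (p * beta0 + (1 - p) * bs) by rewrite -Ebs.
  by clear; lra.
case: (leP bt beta0) => h0t.
  apply: pooled_left => //; apply/ltW/(le_lt_trans _ h2s).
  rewrite -(ler_pM2l p1); have : p * beta0 <= p * x2 by rewrite ler_pM2l.
  by clear - Ebs; lra.
have hbm2 : bm <= beta2.
  rewrite -(ler_pM2l m0); have : (1 - p) * bs < (1 - p) * beta2 by rewrite ltr_pM2l.
  by clear - Ebs Ebm; lra.
have hbm0 : beta0 <= bm.
  rewrite -(ler_pM2l m0); have : (1 - r) * beta0 < (1 - r) * bt by rewrite ltr_pM2l.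
  by clear - Ebt Ebm; lra.
apply: (fin beta0 bm beta2) => //; clear fin.
- by clear - hbm0 hbm2 beta0_ge0 beta2_le1; lra.
- by clear - hbm0 hbm2 beta0_ge0 beta2_le1; lra.
- by clear - hbm0 hbm2 beta0_ge0 beta2_le1; lra.
have := psd (- bm) (bm - beta0) 1 (bm - beta2).
have : 0 <= (bm - beta0) * (beta2 - bm) * eps.
  by rewrite mulr_ge0 // mulr_ge0 // subr_ge0.
have : bm * x2 = bm * (p * beta0 + (1 - p - r) * bm + r * beta2) by rewrite -Ebm.
by clear; lra.
Qed.

(** Change of parameters: [e = (1 - x1) / p] and [f = x3 / r] make [p (1 - Y1) / (1 - x1)] and
    [r Y3 / x3] the pseudo-indicators of B and T; [beta0], [beta2] and [eps] are then read off from
    [X12], [X23] and [X13]. *)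
Lemma obj3_ge_of_moments (R : realFieldType) (q11 q22 q33 q12 q13 q23 c1 c2 c3 v : R)
    (p r x1 x2 x3 X11 X22 X33 X12 X13 X23 : R) :
  submod3_lbound q11 q22 q33 q12 q13 q23 c1 c2 c3 v ->
  (forall z0 z1 z2 z3, 0 <= z0 ^+ 2 + z1 ^+ 2 * X11 + z2 ^+ 2 * X22 + z3 ^+ 2 * X33
     + 2 * (z0 * z1 * x1 + z0 * z2 * x2 + z0 * z3 * x3
            + z1 * z2 * X12 + z1 * z3 * X13 + z2 * z3 * X23)) ->
  X11 <= x1 -> X22 <= x2 -> X33 <= x3 -> X12 <= x2 -> X13 <= x3 -> X23 <= x3 ->
  x1 < 1 -> 0 < x3 -> 0 <= x2 <= 1 -> 0 < p -> 0 < r -> p + r < 1 ->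
  (1 - x1) ^+ 2 = p * (1 - 2 * x1 + X11) -> x3 ^+ 2 = r * X33 ->
  p * (1 - 2 * x2 + X22) <= (1 - x2) ^+ 2 -> r * X22 <= x2 ^+ 2 ->
  v <= obj3 q11 q22 q33 q12 q13 q23 c1 c2 c3 x1 x2 x3 X11 X22 X33 X12 X13 X23.
Proof.
move=> sub psd h11 h22 h33 h12 h13 h23 hx1 x30 hx2 p0 r0 pr Ep Er hp hr.
have g0 : 0 < 1 - x1 by rewrite subr_gt0.
have gn0 : 1 - x1 != 0 by rewrite gt_eqF.
have xn0 : x3 != 0 by rewrite gt_eqF.
have pn0 : p != 0 by rewrite gt_eqF.
have rn0 : r != 0 by rewrite gt_eqF.
have ex1 : x1 = 1 - p * ((1 - x1) / p) by field.
have ex3 : x3 = r * (x3 / r) by field.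
have eX11 : X11 = p * ((1 - x1) / p) ^+ 2 + 1 - 2 * (p * ((1 - x1) / p)).
  have -> : X11 = (1 - x1) ^+ 2 / p - 1 + 2 * x1 by rewrite Ep; field.
  by field.
have eX33 : X33 = r * (x3 / r) ^+ 2.
  have -> : X33 = x3 ^+ 2 / r by rewrite Er; field.
  by field.
have eX12 : X12 = x2 - p * ((1 - x1) / p) * ((x2 - X12) / (1 - x1)).
  by field; rewrite gn0.
have eX13 : X13 = r * (x3 / r)
    - (1 - x1) / p * (x3 / r) * ((x3 - X13) * p * r / ((1 - x1) * x3)).
  by field; rewrite gn0 xn0 pn0 rn0.
have eX23 : X23 = r * (x3 / r) * (X23 / x3) by field; rewrite xn0 rn0.
rewrite [in X in _ <= X]eX11 [in X in _ <= X]eX33 [in X in _ <= X]eX12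
  [in X in _ <= X]eX13 [in X in _ <= X]eX23.
rewrite [X in obj3 _ _ _ _ _ _ _ _ _ X]ex1 [X in obj3 _ _ _ _ _ _ _ _ _ _ _ X]ex3.
apply: obj3_ge_of_events => //.
- apply/andP; split; first by rewrite divr_ge0 // ltW.
  rewrite ler_pdivrMr // mul1r -(ler_pM2l g0) -expr2 Ep mulrC ler_pM2r //.
  clear - h11; lra.
- apply/andP; split; first by rewrite divr_ge0 // ltW.
  by rewrite ler_pdivrMr // mul1r -(ler_pM2l x30) -expr2 Er mulrC ler_pM2r.
- by rewrite divr_ge0 ?subr_ge0 // ltW.
- by rewrite ler_pdivrMr // mul1r.
- by rewrite divr_ge0 ?mulr_ge0 ?subr_ge0 // ltW // mulr_gt0.
move=> a b c d.
(* The combination of 1, the two pseudo-indicators and [Y2], rewritten in 1, [Y1], [Y2], [Y3]. *)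
have := psd (a + b * p / (1 - x1)) (- (b * p / (1 - x1))) c (d * r / x3).
congr (_ <= _).
have -> : X11 = (1 - x1) ^+ 2 / p - 1 + 2 * x1 by rewrite Ep; field.
have -> : X33 = x3 ^+ 2 / r by rewrite Er; field.
by field; rewrite gn0 xn0 pn0 rn0.
Qed.

(** * Matrix expressions as sums, and rank-one feasible points *)

Lemma quad_formE (R : pzRingType) (n : nat) (A : 'M[R]_n) (u w : 'cV[R]_n) :
  (u^T *m A *m w) 0 0 = \sum_i \sum_j u i 0 * A i j * w j 0.
Proof.
rewrite !mxE exchange_big /=; apply: eq_bigr => j _.
by rewrite !mxE mulr_suml; apply: eq_bigr => i _; rewrite !mxE.
Qed.

Lemma qp_objectiveE (R : realType) (n : nat) (Q : 'M[R]_n) (c x : 'cV[R]_n) :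
  qp_objective Q c x
  = \sum_i \sum_j Q i j * (x i 0 * x j 0) + \sum_i c i 0 * x i 0.
Proof.
rewrite /qp_objective quad_formE mxE; congr (_ + _).
  by apply: eq_bigr => i _; apply: eq_bigr => j _; ring.
by apply: eq_bigr => i _; rewrite mxE.
Qed.

Lemma sdp_objectiveE (R : realType) (n : nat) (Q : 'M[R]_n) (c x : 'cV[R]_n)
    (X : 'M[R]_n) :
  sdp_objective Q c (x, X)
  = \sum_i \sum_j Q i j * X i j + \sum_i c i 0 * x i 0.
Proof.
rewrite /sdp_objective /frobenius /mxtrace mxE /= exchange_big /=; congr (_ + _).
  by apply: eq_bigr => i _; rewrite mxE; apply: eq_bigr => j _; rewrite mxE.
by apply: eq_bigr => i _; rewrite mxE.
Qed.

Lemma sdp_objective_rank1 (R : realType) (n : nat) (Q : 'M[R]_n)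
    (c x : 'cV[R]_n) : sdp_objective Q c (x, x *m x^T) = qp_objective Q c x.
Proof.
rewrite sdp_objectiveE qp_objectiveE; congr (_ + _).
apply: eq_bigr => i _; apply: eq_bigr => j _.
by rewrite !mxE big_ord1 !mxE.
Qed.

Lemma border_psdE (R : realType) (n : nat) (x z : 'cV[R]_n) (X : 'M[R]_n) (a : R) :
  ((col_mx a%:M z)^T *m block_mx 1%:M x^T x X *m col_mx a%:M z) 0 0
  = a ^+ 2 + 2 * a * (\sum_i z i 0 * x i 0)
    + \sum_i \sum_j z i 0 * X i j * z j 0.
Proof.
rewrite tr_col_mx mul_row_block mul_row_col tr_scalar_mx !mulmxDl !mulmx1.
rewrite !mul_mx_scalar !mul_scalar_mx -scalemxAl mxE.
rewrite [X in X + _]mxE [X in _ + X]mxE quad_formE !mxE.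
have e1 : \sum_j x^T 0 j * z j 0 = \sum_i z i 0 * x i 0.
  by apply: eq_bigr => j _; rewrite mxE mulrC.
have e2 : \sum_j z^T 0 j * x j 0 = \sum_i z i 0 * x i 0.
  by apply: eq_bigr => j _; rewrite mxE.
by rewrite e1 e2 eqxx mulr1n; ring.
Qed.

Lemma rank1_feasible (R : realType) (n : nat) (x : 'cV[R]_n) :
  qp_feasible x -> sdp_feasible (x, x *m x^T).
Proof.
move=> hx; split => /=.
- by rewrite trmx_mul trmxK.
- move=> i j; rewrite !mxE !big_ord1 !mxE mulr1.
  by have /andP[xi0 _] := hx i; have /andP[_ xj1] := hx j; rewrite ler_piMr.
split; first by rewrite tr_block_mx tr_scalar_mx trmxK trmx_mul trmxK.
move=> v; rewrite -[v]vsubmxK [usubmx v]mx11_scalar border_psdE.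
set a := _ 0 0; set z := dsubmx v.
have -> : \sum_i \sum_j z i 0 * (x *m x^T) i j * z j 0 = (\sum_i z i 0 * x i 0) ^+ 2.
  rewrite expr2 mulr_suml; apply: eq_bigr => i _.
  rewrite mulr_sumr; apply: eq_bigr => j _.
  by rewrite [(x *m x^T) i j]mxE big_ord1 [x^T 0 j]mxE; ring.
set s := \sum_i z i 0 * x i 0.
have -> : a ^+ 2 + 2 * a * s + s ^+ 2 = (a + s) ^+ 2 by ring.
exact: sqr_ge0.
Qed.

Lemma sdp_feasible_sym (R : realType) (n : nat) (x : 'cV[R]_n) (X : 'M[R]_n) i j :
  sdp_feasible (x, X) -> X i j = X j i.
Proof. by case=> /= sX _ _; rewrite -[in LHS]sX mxE. Qed.

(** This is the pseudo-expectation of [(z0 + z1 Y_i + z2 Y_j + z3 Y_k)^2]. The indices may coincide,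
    so variances and pairs are covered too. *)
Lemma sdp_feasible_psd3 (R : realType) (n : nat) (x : 'cV[R]_n) (X : 'M[R]_n)
    (i j k : 'I_n) (z0 z1 z2 z3 : R) :
  sdp_feasible (x, X) ->
  0 <= z0 ^+ 2 + z1 ^+ 2 * X i i + z2 ^+ 2 * X j j + z3 ^+ 2 * X k k
     + 2 * (z0 * z1 * x i 0 + z0 * z2 * x j 0 + z0 * z3 * x k 0
            + z1 * z2 * X i j + z1 * z3 * X i k + z2 * z3 * X j k).
Proof.
move=> H; have [_ _ [_ psd]] := H.
have sX l l' := sdp_feasible_sym l l' H.
pose z : 'cV[R]_n := z1 *: delta_mx i 0 + z2 *: delta_mx j 0 + z3 *: delta_mx k 0.
have dot (F : 'I_n -> R) :
    \sum_l z l 0 * F l = z1 * F i + z2 * F j + z3 * F k.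
  under eq_bigr do rewrite !mxE eqxx !andbT !mulrDl.
  rewrite !big_split /=; congr (_ + _ + _).
  - rewrite (bigD1 i) //= eqxx mulr1 big1 ?addr0 // => l /negbTE->.
    by rewrite mulr0 mul0r.
  - rewrite (bigD1 j) //= eqxx mulr1 big1 ?addr0 // => l /negbTE->.
    by rewrite mulr0 mul0r.
  - rewrite (bigD1 k) //= eqxx mulr1 big1 ?addr0 // => l /negbTE->.
    by rewrite mulr0 mul0r.
have := psd (col_mx z0%:M z); rewrite border_psdE dot.
have -> : \sum_l \sum_l' z l 0 * X l l' * z l' 0
    = \sum_l z l 0 * (\sum_l' z l' 0 * X l l').
  apply: eq_bigr => l _; rewrite mulr_sumr; apply: eq_bigr => l' _; ring.
rewrite dot !dot (sX j i) (sX k i) (sX k j); congr (_ <= _); ring.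
Qed.

(** * Attainment of the minimum over the box *)

Lemma qp_min_exists (R : realType) (n : nat) (Q : 'M[R]_n) (c : 'cV[R]_n) :
  exists2 x, @qp_feasible R n x &
    forall y, @qp_feasible R n y -> qp_objective Q c x <= qp_objective Q c y.
Proof.
pose A := [set u : 'rV[R]_n | forall i, `[0, 1]%classic (u ord0 i)].
have cA : compact A.
  by apply: (@rV_compact R n (fun=> `[(0:R), 1]%classic)) => _; exact: segment_compact.
have A0 : A !=set0.
  by exists 0 => i; rewrite /= in_itv /= mxE lexx ler01.
pose f (u : 'rV[R]_n) := qp_objective Q c u^T.
have cf : continuous f.
  have cc i : continuous (fun u : 'rV[R]_n => u ord0 i) by exact: coord_continuous.
  have -> : f = fun u => \sum_i \sum_j Q i j * (u 0 i * u 0 j) + \sum_i c i 0 * u 0 i.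
    apply/funext => u; rewrite /f qp_objectiveE; congr (_ + _).
      by apply: eq_bigr => i _; apply: eq_bigr => j _; rewrite !mxE.
    by apply: eq_bigr => i _; rewrite !mxE.
  have csum (F : 'I_n -> 'rV[R]_n -> R) :
      (forall i, continuous (F i)) -> continuous (fun u => \sum_i F i u).
    move=> cF; apply: (@continuous_big R 'I_n +%R 0 xpredT) => [|i _]; last exact: cF.
    exact: (@add_continuous R).
  have cmul (F G : 'rV[R]_n -> R) :
      continuous F -> continuous G -> continuous (fun u => F u * G u).
    by move=> cF cG u; exact: (cvgM (cF u) (cG u)).
  have cq : continuous (fun u : 'rV[R]_n => \sum_i \sum_j Q i j * (u 0 i * u 0 j)).
    apply: (csum (fun i u => \sum_j Q i j * (u 0 i * u 0 j))) => i.
    apply: (csum (fun j u => Q i j * (u 0 i * u 0 j))) => j.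
    apply: (cmul (fun=> Q i j) (fun u => u 0 i * u 0 j)); first exact: cst_continuous.
    exact: (cmul (fun u => u 0 i) (fun u => u 0 j)).
  have cl : continuous (fun u : 'rV[R]_n => \sum_i c i 0 * u 0 i).
    apply: (csum (fun i u => c i 0 * u 0 i)) => i.
    exact: (cmul (fun=> c i 0) (fun u => u 0 i) (@cst_continuous _ _ _)).
  by move=> u; exact: (cvgD (cq u) (cl u)).
have [u uA umin] := EVT_min_rV A0 cA (continuous_subspaceT cf).
exists u^T.
  by move=> i; rewrite mxE; move: uA; rewrite inE => /(_ i); rewrite /= in_itv.
move=> y hy; rewrite -[y]trmxK; apply: umin; rewrite inE => i.
by rewrite /= in_itv /= mxE; exact: hy.
Qed.

(** * The ratios bounding the weights of the events *)

(* For E = 0 (whence g = 0, a constant coordinate) the value 1 makes the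
   coordinate compatible with every two-point law, unlike the default g^2 / 0 = 0. *)
Definition sqr_ratio (R : realFieldType) (g E : R) : R :=
  if E == 0 then 1 else g ^+ 2 / E.

Lemma sqr_ratioM (R : realFieldType) (g E : R) :
  g ^+ 2 <= E -> sqr_ratio g E * E = g ^+ 2.
Proof.
rewrite /sqr_ratio => gE; case: eqVneq => [E0|En0]; last by rewrite divfK.
by rewrite E0 mulr0; apply/eqP; rewrite eq_le sqr_ge0 -E0 gE.
Qed.

Lemma sqr_ratio_gt0 (R : realFieldType) (g E : R) : g ^+ 2 <= E <= g -> 0 < sqr_ratio g E.
Proof.
case/andP=> gE Eg; rewrite /sqr_ratio; case: eqVneq => // En0.
have E0 : 0 < E by rewrite lt_neqAle eq_sym En0 (le_trans _ gE) ?sqr_ge0.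
by rewrite divr_gt0 // exprn_gt0 // (lt_le_trans E0).
Qed.

Lemma sqr_ratio_le1 (R : realFieldType) (g E : R) : g ^+ 2 <= E -> sqr_ratio g E <= 1.
Proof.
rewrite /sqr_ratio => gE; case: eqVneq => // En0.
have E0 : 0 < E by rewrite lt_neqAle eq_sym En0 (le_trans _ gE) ?sqr_ge0.
by rewrite ler_pdivrMr // mul1r.
Qed.

Lemma sqr_ratio_lt1 (R : realFieldType) (g E : R) :
  g ^+ 2 <= E <= g -> sqr_ratio g E < 1 -> 0 < g.
Proof.
case/andP=> gE Eg; rewrite /sqr_ratio; case: eqVneq; first by rewrite ltxx.
move=> En0 _; apply: lt_le_trans Eg.
by rewrite lt_neqAle eq_sym En0 (le_trans _ gE) ?sqr_ge0.
Qed.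

(** Clearing denominators leaves [(x - X) ((x - x^2) + (X - x^2))], a product of nonnegative
    factors. This later keeps the two minimizing indices apart. *)
Lemma sqr_ratio_compl (R : realFieldType) (x X : R) : x ^+ 2 <= X <= x ->
  1 <= sqr_ratio (1 - x) (1 - 2 * x + X) + sqr_ratio x X.
Proof.
move=> /andP[xX Xx].
have r0 : 0 < sqr_ratio x X by apply: sqr_ratio_gt0; rewrite xX.
have p0 : 0 < sqr_ratio (1 - x) (1 - 2 * x + X).
  by apply: sqr_ratio_gt0; apply/andP; split; lra.
have [X0|Xn0] := eqVneq X 0.
  have -> : sqr_ratio x X = 1 by rewrite /sqr_ratio X0 eqxx.
  by rewrite lerDr ltW.
have [E0|En0] := eqVneq (1 - 2 * x + X) 0.
  have -> : sqr_ratio (1 - x) (1 - 2 * x + X) = 1 by rewrite /sqr_ratio E0 eqxx.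
  by rewrite lerDl ltW.
rewrite /sqr_ratio (negbTE Xn0) (negbTE En0).
have X0 : 0 < X by rewrite lt_neqAle eq_sym Xn0 (le_trans _ xX) ?sqr_ge0.
have E0 : 0 < 1 - 2 * x + X.
  rewrite lt_neqAle eq_sym En0 /=.
  by apply: le_trans (sqr_ge0 (1 - x)) _; lra.
rewrite addf_div // ler_pdivlMr ?mulr_gt0 // mul1r -subr_ge0.
have -> : (1 - x) ^+ 2 * X + x ^+ 2 * (1 - 2 * x + X) - (1 - 2 * x + X) * X
  = (x - X) * (x - x ^+ 2 + (X - x ^+ 2)) by ring.
by apply: mulr_ge0; lra.
Qed.

(** * The perfectly correlated two-point law *)

Lemma sdp_feasible_diag (R : realType) (n : nat) (x : 'cV[R]_n) (X : 'M[R]_n) i :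
  sdp_feasible (x, X) -> x i 0 ^+ 2 <= X i i <= x i 0.
Proof.
move=> H; apply/andP; split.
  by have := sdp_feasible_psd3 i i i (- x i 0) 1 0 0 H; lra.
by case: H => _ /(_ i i); rewrite !mxE big_ord1 !mxE mulr1.
Qed.

Lemma sdp_feasible_entry (R : realType) (n : nat) (x : 'cV[R]_n) (X : 'M[R]_n) i j :
  sdp_feasible (x, X) -> X i j <= x j 0.
Proof.
move=> H; rewrite (sdp_feasible_sym i j H).
by case: H => _ /(_ j i); rewrite !mxE big_ord1 !mxE mulr1.
Qed.

(** The law takes [lo] with weight [p] and [hi] with weight [1 - p], each coordinate having mean
    [x i 0] and variance [X i i - x i 0 ^+ 2]. The last two hypotheses say exactly that [hi <= 1]
    and [lo >= 0]. *)
Lemma sdp_ge_two_atoms (R : realType) (n : nat) (Q : 'M[R]_n) (c x : 'cV[R]_n)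
    (X : 'M[R]_n) (p v : R) :
  (forall i j : 'I_n, i != j -> Q i j <= 0) ->
  (forall y, @qp_feasible R n y -> v <= qp_objective Q c y) ->
  sdp_feasible (x, X) -> 0 < p < 1 ->
  (forall i, p * (1 - 2 * x i 0 + X i i) <= (1 - x i 0) ^+ 2) ->
  (forall i, (1 - p) * X i i <= x i 0 ^+ 2) ->
  v <= sdp_objective Q c (x, X).
Proof.
move=> Qoff vle H /andP[p0 p1] hlo hhi.
have q0 : 0 < 1 - p by rewrite subr_gt0.
pose s : R := Num.sqrt ((1 - p) / p).
have s20 : 0 < (1 - p) / p by rewrite divr_gt0.
have s0 : 0 < s by rewrite sqrtr_gt0.
have ss : p * s ^+ 2 = 1 - p.
  by rewrite sqr_sqrtr ?(ltW s20) // mulrC divfK // gt_eqF.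
have sn0 : s != 0 by rewrite gt_eqF.
pose d i : R := X i i - x i 0 ^+ 2.
have d0 i : 0 <= d i by have := sdp_feasible_diag i H; rewrite subr_ge0 => /andP[].
have sd2 i : Num.sqrt (d i) ^+ 2 = d i by rewrite sqr_sqrtr.
have sd0 i : 0 <= Num.sqrt (d i) by rewrite sqrtr_ge0.
have xb i : 0 <= x i 0 <= 1.
  by have /andP[h1 h2] := sdp_feasible_diag i H; nra.
(* A pseudo-covariance is at most the product of the standard deviations, which the law attains. *)
have cov i j : X i j <= x i 0 * x j 0 + Num.sqrt (d i) * Num.sqrt (d j).
  rewrite -lerBlDl; apply: (@psd2_le _ (d i) (d j)) => //.
  - move=> b t.
    have := sdp_feasible_psd3 i j j (- (b * x i 0 + t * x j 0)) b t 0 H.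
    by rewrite /d; lra.
  - by rewrite mulr_ge0.
  - by rewrite exprMn !sd2.
pose lo : 'cV[R]_n := \col_i (x i 0 - Num.sqrt (d i) * s).
pose hi : 'cV[R]_n := \col_i (x i 0 + Num.sqrt (d i) / s).
have lo_box : qp_feasible lo.
  move=> i; rewrite mxE; have /andP[x0 x1] := xb i.
  apply/andP; split; last first.
    by apply: le_trans x1; rewrite gerBl mulr_ge0 // ltW.
  rewrite subr_ge0 -(@ler_pXn2r _ 2) ?nnegrE // ?mulr_ge0 ?(ltW s0) //.
  rewrite exprMn sd2 -(ler_pM2l p0) mulrCA ss /d.
  by have := hhi i; lra.
have hi_box : qp_feasible hi.
  move=> i; rewrite mxE; have /andP[x0 x1] := xb i.
  apply/andP; split; first by rewrite addr_ge0 // divr_ge0 // ltW.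
  rewrite -lerBrDl ler_pdivrMr // -(@ler_pXn2r _ 2) ?nnegrE //;
    rewrite ?mulr_ge0 ?subr_ge0 ?(ltW s0) //.
  rewrite exprMn sd2 -(ler_pM2l p0) mulrCA ss /d.
  by have := hlo i; lra.
have mean i : p * lo i 0 + (1 - p) * hi i 0 = x i 0.
  rewrite !mxE; set u := Num.sqrt _.
  have -> : p * (x i 0 - u * s) + (1 - p) * (x i 0 + u / s)
    = x i 0 + u / s * (1 - p - p * s ^+ 2) by field.
  by rewrite ss subrr mulr0 addr0.
have second i j : p * (lo i 0 * lo j 0) + (1 - p) * (hi i 0 * hi j 0)
    = x i 0 * x j 0 + Num.sqrt (d i) * Num.sqrt (d j).
  rewrite !mxE; set u := Num.sqrt _; set w := Num.sqrt _.
  (* Grouped so that [ss] cancels the terms linear in [u] and [w]. *)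
  have -> : p * ((x i 0 - u * s) * (x j 0 - w * s))
      + (1 - p) * ((x i 0 + u / s) * (x j 0 + w / s))
    = x i 0 * x j 0 + (p * s ^+ 2 - (1 - p)) * (- (x i 0 * w + x j 0 * u) / s)
      + (p * s ^+ 2) * (u * w) + (1 - p) / s ^+ 2 * (u * w) by field.
  by rewrite ss subrr mul0r addr0 -[in X in X / _]ss mulfK ?expf_neq0 //; ring.
apply: (@le_trans _ _ (p * qp_objective Q c lo + (1 - p) * qp_objective Q c hi)).
  have := ler_wpM2l (ltW p0) (vle _ lo_box).
  by have := ler_wpM2l (ltW q0) (vle _ hi_box); lra.
rewrite !qp_objectiveE sdp_objectiveE !mulrDr addrACA lerD //; last first.
  rewrite !mulr_sumr -big_split /= ler_sum // => i _.
  by rewrite -(mean i) le_eqVlt; apply/orP; left; apply/eqP; ring.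
rewrite !mulr_sumr -big_split /= ler_sum // => i _.
rewrite !mulr_sumr -big_split /= ler_sum // => j _.
have -> : p * (Q i j * (lo i 0 * lo j 0)) + (1 - p) * (Q i j * (hi i 0 * hi j 0))
  = Q i j * (p * (lo i 0 * lo j 0) + (1 - p) * (hi i 0 * hi j 0)) by ring.
(* The diagonal moments agree exactly; off the diagonal [cov] meets the sign of [Q]. *)
rewrite second; case: (eqVneq i j) => [<-|ij].
  by rewrite -!expr2 sd2 /d addrC subrK.
by rewrite ler_wnM2l // Qoff.
Qed.

(** * From matrices to three scalar coordinates *)

Lemma big_uniq_cover (R : nmodType) (T : finType) (s : seq T) (F : T -> R) :
  uniq s -> (forall l, l \in s) -> \sum_l F l = \sum_(l <- s) F l.
Proof.
move=> us hs; rewrite -(big_enum _) /=; apply: perm_big.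
by apply: uniq_perm => //; [exact: enum_uniq | move=> l; rewrite mem_enum hs].
Qed.

(** The index other than [i] and [k], if there is one, becomes the middle coordinate. *)
Lemma sdp_ge_of_separated (R : realType) (n : nat) (Q : 'M[R]_n) (c x : 'cV[R]_n)
    (X : 'M[R]_n) (p r v : R) (i k : 'I_n) :
  (n <= 3)%N -> Q^T = Q ->
  (forall i j : 'I_n, i != j -> Q i j <= 0) ->
  (forall y, @qp_feasible R n y -> v <= qp_objective Q c y) ->
  sdp_feasible (x, X) -> i != k ->
  x i 0 < 1 -> 0 < x k 0 -> 0 < p -> 0 < r -> p + r < 1 ->
  (1 - x i 0) ^+ 2 = p * (1 - 2 * x i 0 + X i i) -> x k 0 ^+ 2 = r * X k k ->
  (forall j, p * (1 - 2 * x j 0 + X j j) <= (1 - x j 0) ^+ 2) ->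
  (forall j, r * X j j <= x j 0 ^+ 2) ->
  v <= sdp_objective Q c (x, X).
Proof.
move=> n3 symQ Qoff vle H ik xi1 xk0 p0 r0 pr Ep Er hp hr.
have sQ l l' : Q l l' = Q l' l by rewrite -[in LHS]symQ mxE.
have sX l l' := sdp_feasible_sym l l' H.
have diag l : X l l <= x l 0 by exact: sdp_feasible_entry.
have xb l : 0 <= x l 0 <= 1.
  by have /andP[h1 h2] := sdp_feasible_diag l H; nra.
case: (pickP [pred j | j \notin [:: i; k]]) => [j /= jik | all2].
  have [ji jk] : j != i /\ j != k by move: jik; rewrite !inE negb_or => /andP.
  have us : uniq [:: i; j; k].
    by rewrite /= !inE negb_or ik (eq_sym i j) ji jk.
  have hs l : l \in [:: i; j; k].
    apply/negPn/negP => hl.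
    (* A fourth index would contradict [n <= 3]. *)
    have us4 : uniq (l :: [:: i; j; k]) by rewrite cons_uniq hl.
    have := max_card (mem (l :: [:: i; j; k])).
    by rewrite (card_uniqP us4) card_ord => /leq_trans/(_ n3).
  have -> : sdp_objective Q c (x, X) =
      obj3 (Q i i) (Q j j) (Q k k) (Q i j) (Q i k) (Q j k) (c i 0) (c j 0) (c k 0)
        (x i 0) (x j 0) (x k 0) (X i i) (X j j) (X k k) (X i j) (X i k) (X j k).
    rewrite sdp_objectiveE !(big_uniq_cover _ us hs) !big_cons !big_nil.
    rewrite !(big_uniq_cover _ us hs) !big_cons !big_nil.
    rewrite (sQ j i) (sQ k i) (sQ k j) (sX j i) (sX k i) (sX k j) /obj3; ring.
  apply: (@obj3_ge_of_moments _ _ _ _ _ _ _ _ _ _ _ p r) => //;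
    try exact: sdp_feasible_entry.
  - split; try by apply: Qoff; rewrite // eq_sym.
    move=> y1 y2 y3 h1 h2 h3.
    pose y : 'cV[R]_n := \col_l (if l == i then y1 else if l == j then y2 else y3).
    have yb : qp_feasible y by move=> l; rewrite mxE; do 2?case: ifP.
    have yi : y i 0 = y1 by rewrite mxE eqxx.
    have yj : y j 0 = y2 by rewrite mxE (negbTE ji) eqxx.
    have yk : y k 0 = y3 by rewrite mxE eq_sym (negbTE ik) eq_sym (negbTE jk).
    have := vle _ yb; rewrite qp_objectiveE !(big_uniq_cover _ us hs) !big_cons !big_nil.
    rewrite !(big_uniq_cover _ us hs) !big_cons !big_nil yi yj yk.
    rewrite (sQ j i) (sQ k i) (sQ k j) /obj3; congr (_ <= _); ring.
  - by move=> z0 z1 z2 z3; exact: sdp_feasible_psd3.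
have us : uniq [:: i; k] by rewrite /= inE ik.
have hs l : l \in [:: i; k] by apply/negPn/negP => hl; have := all2 l; rewrite /= hl.
(* With only two indices, the middle coordinate is a dummy whose data are all zero. *)
have -> : sdp_objective Q c (x, X) =
    obj3 (Q i i) 0 (Q k k) 0 (Q i k) 0 (c i 0) 0 (c k 0)
      (x i 0) 0 (x k 0) (X i i) 0 (X k k) 0 (X i k) 0.
  rewrite sdp_objectiveE !(big_uniq_cover _ us hs) !big_cons !big_nil.
  rewrite !(big_uniq_cover _ us hs) !big_cons !big_nil.
  rewrite (sQ k i) (sX k i) /obj3; ring.
apply: (@obj3_ge_of_moments _ _ _ _ _ _ _ _ _ _ _ p r) => //;
    try exact: sdp_feasible_entry.
- split=> //; first exact: Qoff.
  move=> y1 y2 y3 h1 h2 h3.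
  pose y : 'cV[R]_n := \col_l (if l == i then y1 else y3).
  have yb : qp_feasible y by move=> l; rewrite mxE; case: ifP.
  have yi : y i 0 = y1 by rewrite mxE eqxx.
  have yk : y k 0 = y3 by rewrite mxE eq_sym (negbTE ik).
  have := vle _ yb; rewrite qp_objectiveE !(big_uniq_cover _ us hs) !big_cons !big_nil.
  rewrite !(big_uniq_cover _ us hs) !big_cons !big_nil yi yk.
  rewrite (sQ k i) /obj3; congr (_ <= _); ring.
- move=> z0 z1 z2 z3; have := sdp_feasible_psd3 i k k z0 z1 z3 0 H.
  by congr (_ <= _); ring.
- by have /andP[] := xb k.
- by rewrite lexx ler01.
- by clear - pr r0; lra.
- by rewrite mulr0 expr0n.
Qed.

(** * Choice of the law, and tightness *)

Lemma sdp_ge_qp (R : realType) (n : nat) (Q : 'M[R]_n) (c x : 'cV[R]_n)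
    (X : 'M[R]_n) (v : R) :
  (1 <= n)%N -> (n <= 3)%N -> Q^T = Q ->
  (forall i j : 'I_n, i != j -> Q i j <= 0) ->
  (forall y, @qp_feasible R n y -> v <= qp_objective Q c y) ->
  sdp_feasible (x, X) -> v <= sdp_objective Q c (x, X).
Proof.
move=> n1 n3 symQ Qoff vle H.
pose E i : R := 1 - 2 * x i 0 + X i i.
pose P i := sqr_ratio (1 - x i 0) (E i).
pose S i := sqr_ratio (x i 0) (X i i).
have diag i := sdp_feasible_diag i H.
have diagE i : (1 - x i 0) ^+ 2 <= E i <= 1 - x i 0.
  by have /andP[h1 h2] := diag i; rewrite /E; apply/andP; split; lra.
have PE i : P i * E i = (1 - x i 0) ^+ 2 by apply: sqr_ratioM; have /andP[] := diagE i.
have SX i : S i * X i i = x i 0 ^+ 2 by apply: sqr_ratioM; have /andP[] := diag i.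
have X0 i : 0 <= X i i by have /andP[h _] := diag i; apply: le_trans h; exact: sqr_ge0.
have E0 i : 0 <= E i by have /andP[h _] := diagE i; apply: le_trans h; exact: sqr_ge0.
have [i _ Pmin] := @arg_minP _ _ _ (Ordinal n1) xpredT P isT.
have [k _ Smin] := @arg_minP _ _ _ (Ordinal n1) xpredT S isT.
have P0 : 0 < P i := sqr_ratio_gt0 (diagE i).
have S0 : 0 < S k := sqr_ratio_gt0 (diag k).
have hP j : P i * E j <= (1 - x j 0) ^+ 2 by rewrite -PE ler_wpM2r // Pmin.
have hS j : S k * X j j <= x j 0 ^+ 2 by rewrite -SX ler_wpM2r // Smin.
have [PS|PS] := ltP (P i + S k) 1.
  apply: (@sdp_ge_of_separated _ _ _ _ _ _ (P i) (S k) _ i k) => //.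
  - apply/eqP => ik; have := sqr_ratio_compl (diag i).
    by rewrite -/(E i) -/(P i) -/(S i) {2}ik leNgt PS.
  - rewrite -subr_gt0; apply: (sqr_ratio_lt1 (diagE i)).
    by apply: lt_trans PS; rewrite ltrDl.
  - by apply: (sqr_ratio_lt1 (diag k)); apply: lt_trans PS; rewrite ltrDr.
(* Here [1 - P i <= S k], so the weight [P i] keeps both atoms in the box. *)
have hS' j : (1 - P i) * X j j <= x j 0 ^+ 2.
  by apply: le_trans (hS j); rewrite ler_wpM2r // lerBlDl.
have P1 : P i <= 1 by apply: sqr_ratio_le1; have /andP[] := diagE i.
have [P1'|P1'] := ltP (P i) 1.
  by apply: (@sdp_ge_two_atoms _ _ _ _ _ _ (P i)) => //; rewrite P0.
have eP : P i = 1 by apply/eqP; rewrite eq_le P1.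
(* [P i = 1] forces [X j j = x j 0 ^+ 2] for all [j]: both atoms equal [x], and 1/2 serves as a
   weight strictly between 0 and 1. *)
apply: (@sdp_ge_two_atoms _ _ _ _ _ _ (1 / 2)) => //.
- by apply/andP; split; lra.
- move=> j; have := hP j; rewrite eP mul1r; apply: le_trans.
  by rewrite -/(E j) ler_piMl //; lra.
move=> j; have := hP j; have := diag j; have := X0 j.
by rewrite eP mul1r /E => h /andP[h1 h2] h3; lra.
Qed.

Theorem theorem1 (R : realType) (n : nat) (n_ge1 : (1 <= n)%N)
    (n_le3 : (n <= 3)%N) (Q : 'M[R]_n) (c : 'cV[R]_n)
    (Q_sym : Q^T = Q)
    (Q_offdiag : forall i j : 'I_n, i != j -> Q i j <= 0) :
  sdp_tight Q c.
Proof.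
have [x hx xmin] := qp_min_exists Q c.
exists (qp_objective Q c x); split; split.
- by exists x.
- by move=> _ [y hy <-]; exact: xmin.
- by exists (x, x *m x^T); [exact: rank1_feasible | exact: sdp_objective_rank1].
- by move=> _ [[y X] hyX <-]; exact: sdp_ge_qp.
Qed.
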